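(* Let $S$ be a countably infinite, (left) amenable, (two-sided) cancellative semigroup with a Følner sequence $F=(F_N)_{N\in\mathbb{N}}$. For every measure preserving system $(X,\mathcal{B},\mu,(T_s)_{s\in S})$ and every $B\in\mathcal{B}$ there exists a subset $A\subseteq S$ such that for all $k\in\mathbb{N}$ and $h_1,\dots,h_k\in S$ the density on the left below exists and $$d_F\left(h_1^{-1}A\cap\dots\cap h_k^{-1}A\right)=\mu\left(T_{h_1}^{-1}B\cap\dots\cap T_{h_k}^{-1}B\right).$$
   Context: For a semigroup $S$, $A\subseteq S$ and $s\in S$, let $s^{-1}A=\{x\in S: sx\in A\}$. $S$ is (left) amenable if there is a finitely additive probability measure $m:\mathcal{P}(S)\to[0,1]$ with $m(s^{-1}A)=m(A)$ for all $s\in S$, $A\subseteq S$. $S$ is cancellative if for all $a,b,c\in S$, $ab=ac$ implies $b=c$ and $ba=ca$ implies $b=c$. A Følner sequence in $S$ is a sequence $(F_N)_{N\in\mathbb{N}}$ of (nonempty) finite subsets of $S$ with $\lim_{N\to\infty}\frac{|F_N\Delta sF_N|}{|F_N|}=0$ for all $s\in S$. For $E\subseteq S$, $d_F(E):=\lim_{N\to\infty}\frac{|E\cap F_N|}{|F_N|}$ when this limit exists. A measure preserving system $(X,\mathcal{B},\mu,(T_s)_{s\in S})$ is a probability space $(X,\mathcal{B},\mu)$ with an action of $S$ by (not necessarily invertible) measure preserving maps $T_s:X\to X$, i.e. $T_s\circ T_t=T_{st}$ for all $s,t\in S$; $T_h^{-1}B$ denotes the preimage of $B$. *)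

(* Defs.v *)
From mathcomp Require Export all_boot all_order all_algebra.
From mathcomp Require Export finmap.
From mathcomp Require Export all_classical all_reals all_analysis.
Export numFieldNormedType.Exports.

Set Implicit Arguments.
Unset Strict Implicit.
Unset Printing Implicit Defensive.

Import Order.TTheory GRing.Theory Num.Theory.
Local Open Scope classical_set_scope.
Local Open Scope ring_scope.

Section Semigroups.
Context (R : realType) (S : semigroupType).

(* No inverse in S is involved: this is the preimage of A under x |-> s x. *)
Definition ltranslate_preimage (s : S) (A : set S) : set S :=
  [set x | A (s * x)%g].

Definition cancellative : Prop :=
  forall a b c : S,
    ((a * b)%g = (a * c)%g -> b = c) /\ ((b * a)%g = (c * a)%g -> b = c).

Definition finitely_additive_probability (m : set S -> R) : Prop :=
  [/\ forall A, 0 <= m A <= 1,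
      m [set: S] = 1 &
      forall A B, A `&` B = set0 -> m (A `|` B) = m A + m B].

Definition left_amenable : Prop :=
  exists2 m : set S -> R, finitely_additive_probability m &
    forall (s : S) (A : set S), m (ltranslate_preimage s A) = m A.

Definition fset_symdiff (K L : {fset S}) : {fset S} :=
  ((K `\` L) `|` (L `\` K))%fset.

Definition fset_ltranslate (s : S) (K : {fset S}) : {fset S} :=
  [fset (s * x)%g | x in K]%fset.

Definition folner_sequence (F : nat -> {fset S}) : Prop :=
  (forall N, F N != fset0) /\
  forall s : S,
    ((#|` fset_symdiff (F N) (fset_ltranslate s (F N))|)%:R
       / (#|` F N|)%:R : R) @[N --> \oo] --> (0 : R).

(* The limit defining d_F(E) exists and is equal to l. *)
Definition has_density (F : nat -> {fset S}) (E : set S) (l : R) : Prop :=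
  ((#|` [fset x in F N | x \in E]%fset|)%:R
     / (#|` F N|)%:R : R) @[N --> \oo] --> l.

Definition measure_preserving_action (d : measure_display)
    (X : measurableType d) (mu : probability X R) (T : S -> X -> X) : Prop :=
  [/\ forall s, measurable_fun [set: X] (T s),
      forall s (B : set X), measurable B -> mu (T s @^-1` B) = mu B &
      forall s t, T s \o T t = T (s * t)%g].

End Semigroups.

Arguments cancellative S : clear implicits.
Arguments left_amenable R S : clear implicits.
Arguments folner_sequence R {S} F.

(* Main.v *)
Require Import Defs.
From mathcomp Require Import lra ring.

(** Ornstein-Weiss quasi-tilings, which work in any cancellative semigroup with
    Folner sets, partition S up to a small error into pairwise disjoint tiles that
    are almost invariant and of bounded size, in such a way that every
    sufficiently invariant finite set is almost a union of tiles.

    On a tile V contained in a translate P c, copy the orbit of a point x of X: put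
    t c in A iff T_t x lies in B.  The mean over x of the resulting frequencies is
    the right one.  Inside every tile of a second, much coarser tiling, choose the
    points of the small tiles greedily so that the deviations from the mean do not
    accumulate.  This gives, for a finite H and eps > 0, a set whose H-patterns have
    frequency within eps of the correct value on all sufficiently invariant sets.

    Finally glue these sets for a sequence of H increasing to S and eps tending to 0:
    pass from one to the next along finite unions of tiles that are negligible in
    the later F_N. *)

Set Implicit Arguments.
Unset Strict Implicit.
Unset Printing Implicit Defensive.

Import Order.TTheory GRing.Theory Num.Theory.
Local Open Scope classical_set_scope.
Local Open Scope ring_scope.

(** * Counting in finite sets *)

Section Counting.
Context (R : realType) (S : choiceType).
Implicit Types (E : {fset S}) (A : set S).

Definition cnt E A : R := (#|` [fset x in E | x \in A]%fset|)%:R.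

Definition fsize E : R := (#|` E|)%:R.

Lemma in_fset_setP E A x :
  reflect (x \in E /\ A x) (x \in [fset y in E | y \in A]%fset).
Proof.
apply: (iffP idP); first by rewrite !inE => /andP[-> /set_mem].
by move=> [xE Ax]; rewrite !inE xE; apply/mem_set.
Qed.

Lemma fsize_sum E : fsize E = \sum_(x <- E) 1.
Proof. by rewrite /fsize card_fset_sum1 natr_sum. Qed.

Lemma cnt_sum E A : cnt E A = \sum_(x <- E) (x \in A)%:R.
Proof.
rewrite /cnt card_fset_sum1 natr_sum big_fset /= big_mkcond /=.
by apply: eq_bigr => x _; case: (x \in A).
Qed.

Lemma fsize_ge0 E : 0 <= fsize E.
Proof. exact: ler0n. Qed.

Lemma fsize_gt0 E : E != fset0 -> 0 < fsize E.
Proof. by move=> E0; rewrite ltr0n cardfs_gt0. Qed.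

Lemma fsizeS E E' : (E `<=` E')%fset -> fsize E <= fsize E'.
Proof. by move=> EE'; rewrite ler_nat fsubset_leq_card. Qed.

Lemma cnt_ge0 E A : 0 <= cnt E A.
Proof. exact: ler0n. Qed.

Lemma cnt_le_fsize E A : cnt E A <= fsize E.
Proof.
by apply: fsizeS; apply/fsubsetP => x; rewrite !inE => /andP[].
Qed.

Lemma cnt_le_image (g : S -> S) E A E' A' :
  (forall x, x \in E -> A x -> exists y, [/\ y \in E', A' y & x = g y]) ->
  cnt E A <= cnt E' A'.
Proof.
move=> H; rewrite /cnt ler_nat.
apply: (@leq_trans #|` [fset g y | y in [fset y in E' | y \in A']]%fset|); last first.
  exact: leq_imfset_card.
apply/fsubset_leq_card/fsubsetP => x; rewrite !inE => /andP[xE /set_mem Ax].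
have [y [yE A'y ->]] := H x xE Ax.
by apply/imfsetP; exists y => //=; rewrite !inE yE; apply/mem_set.
Qed.

Lemma cnt_le_inj (g : S -> S) E A E' A' : injective g ->
  (forall x, x \in E -> A x -> g x \in E' /\ A' (g x)) ->
  cnt E A <= cnt E' A'.
Proof.
move=> g_inj H; rewrite /cnt ler_nat.
set D := [fset x in E | _]%fset.
have <- : #|` [fset g x | x in D]%fset| = #|` D| by exact: card_imfset.
rewrite /D.
apply/fsubset_leq_card/fsubsetP => _ /imfsetP[x /= + ->].
rewrite !inE => /andP[xE /set_mem Ax].
by have [-> A'gx] := H x xE Ax; apply/mem_set.
Qed.

Lemma cnt_le E A A' : (forall x, x \in E -> A x -> A' x) -> cnt E A <= cnt E A'.
Proof. by move=> H; apply: (@cnt_le_inj id) => // x xE Ax; split=> //; exact: H. Qed.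

Lemma cntU E A A' : cnt E (A `|` A') <= cnt E A + cnt E A'.
Proof.
rewrite !cnt_sum -big_split /=; apply: ler_sum => x _.
by rewrite in_setU; case: (x \in A); case: (x \in A'); rewrite /= ?addr0 ?add0r ?lexx// ler_wpDl.
Qed.

Lemma cntC E A : cnt E (~` A) = fsize E - cnt E A.
Proof.
rewrite fsize_sum !cnt_sum -sumrB; apply: eq_bigr => x _.
by rewrite in_setC; case: (x \in A); rewrite ?subrr ?subr0.
Qed.

Lemma cnt_exists_sum (I : choiceType) (K : {fset I}) E (A : I -> set S) :
  cnt E [set x | exists2 i, i \in K & A i x] <= \sum_(i <- K) cnt E (A i).
Proof.
under eq_bigr do rewrite cnt_sum.
rewrite exchange_big /= cnt_sum; apply: ler_sum => x _.
case: (boolP (x \in _)) => [/set_mem[i iK Aix]|_]; last by rewrite sumr_ge0.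
rewrite (big_fsetD1 i) //= mem_set // lerDl sumr_ge0 //.
Qed.

Lemma cnt_exists (I : choiceType) (K : {fset I}) E (A : I -> set S) (b : R) :
  (forall i, i \in K -> cnt E (A i) <= b) ->
  cnt E [set x | exists2 i, i \in K & A i x] <= (#|` K|)%:R * b.
Proof.
move=> H; apply: le_trans (cnt_exists_sum _ _ _) _.
rewrite card_fset_sum1 natr_sum mulr_suml big_seq [leRHS]big_seq.
by apply: ler_sum => i iK; rewrite mul1r H.
Qed.

Lemma cnt_sub E E' A : (E `<=` E')%fset -> cnt E A <= cnt E' A.
Proof. by move=> /fsubsetP EE'; apply: (@cnt_le_inj id) => // x /EE'. Qed.

Lemma sum_tiles (I : choiceType) (tiles : {fset I}) (v : I -> {fset S}) E
    (phi : S -> R) :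
  (forall i, i \in tiles -> (v i `<=` E)%fset) ->
  (forall i j x, i \in tiles -> j \in tiles -> x \in v i -> x \in v j -> i = j) ->
  \sum_(x <- E) phi x = \sum_(i <- tiles) \sum_(x <- v i) phi x +
    \sum_(x <- E) (x \in [set x | forall i, i \in tiles -> x \notin v i])%:R * phi x.
Proof.
move=> sub disj.
have -> : \sum_(i <- tiles) \sum_(x <- v i) phi x =
    \sum_(i <- tiles) \sum_(x <- E) (x \in v i)%:R * phi x.
  rewrite big_seq [RHS]big_seq; apply: eq_bigr => i it.
  rewrite [RHS](eq_bigr (fun x => if x \in v i then phi x else 0)); last first.
    by move=> x _; case: (x \in v i); rewrite ?mul1r ?mul0r.
  rewrite -big_mkcond /= [RHS]big_fset_condE.
  apply: eq_fbigl => x; rewrite !inE /= andbC; case: (boolP (x \in v i)) => //= xv.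
  by apply/esym; exact: (fsubsetP (sub _ it)).
rewrite exchange_big /= -big_split /=; rewrite big_seq [RHS]big_seq; apply: eq_bigr => x xE.
rewrite -mulr_suml -mulrDl -[LHS]mul1r; congr (_ * _).
case: (boolP (x \in _)) => [/set_mem H|/negP H].
  rewrite big_seq big1 ?add0r // => i it.
  by rewrite (negbTE (H i it)).
have [i it xi] : exists2 i, i \in tiles & x \in v i.
  apply: contrapT => K; apply: H; apply/mem_set => i it; apply/negP => xi.
  by apply: K; exists i.
rewrite (big_fsetD1 i) //= xi big_seq big1 ?addr0 // => j.
rewrite !inE => /andP[ji jt]; case: (boolP (x \in v j)) => // xj.
by rewrite (disj _ _ _ jt it xj xi) eqxx in ji.
Qed.

Lemma sum_fsize_tiles (I : choiceType) (tiles : {fset I}) (v : I -> {fset S}) E :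
  (forall i, i \in tiles -> (v i `<=` E)%fset) ->
  (forall i j x, i \in tiles -> j \in tiles -> x \in v i -> x \in v j -> i = j) ->
  \sum_(i <- tiles) fsize (v i) <= fsize E.
Proof.
move=> sub disj; rewrite (fsize_sum E) (sum_tiles (fun=> 1) sub disj).
under eq_bigr do rewrite fsize_sum.
by rewrite lerDl sumr_ge0 // => x _; rewrite mulr1.
Qed.

End Counting.

(** * Almost invariant finite sets *)

Section Invariance.
Context (R : realType) (S : semigroupType).
Hypothesis S_cancel : cancellative S.
Implicit Types (E K P : {fset S}) (A : set S).

(** When [S] is left cancellative, the count is the size of [s E \ E], which is half that of the
    symmetric difference of [E] and [s E]. *)
Definition invariant K (del : R) E :=
  forall s, s \in K -> cnt R E [set x | (s * x)%g \notin E] <= del * fsize R E.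

Lemma ltranslate_inj (s : S) : injective (fun x : S => (s * x)%g).
Proof. by move=> x y; case: (S_cancel s x y). Qed.

Lemma rtranslate_inj (s : S) : injective (fun x : S => (x * s)%g).
Proof. by move=> x y; case: (S_cancel s x y). Qed.

Lemma invariant_le K K' (del del' : R) E :
  (K' `<=` K)%fset -> del <= del' -> invariant K del E -> invariant K' del' E.
Proof.
move=> /fsubsetP K'K dd' H s /K'K /H /le_trans; apply.
by rewrite ler_wpM2r ?fsize_ge0.
Qed.

Lemma cntT E : cnt R E setT = fsize R E.
Proof. by rewrite cnt_sum fsize_sum; apply: eq_bigr => x _; rewrite in_setT. Qed.

(** By left cancellation [E] and [s E] have equally many points, so [E \ s E] is no larger than
    [s E \ E]. *)
Lemma cnt_not_ltranslate (s : S) E :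
  cnt R E [set y | ~ exists2 x, x \in E & y = (s * x)%g] <=
  cnt R E [set x | (s * x)%g \notin E].
Proof.
have -> : [set y | ~ exists2 x, x \in E & y = (s * x)%g] =
  ~` [set y | exists2 x, x \in E & y = (s * x)%g] by [].
have -> : [set x | (s * x)%g \notin E] = ~` [set x | (s * x)%g \in E].
  by apply/seteqP; split=> x /= /negP.
rewrite !cntC lerD2l lerN2; apply: (cnt_le_inj _ (@ltranslate_inj s)) => x xE sxE.
by split=> //; exists x.
Qed.

(** Points of translates [P c] that stick out of [E]. Tiles are only known to lie in such
    translates, so the points of [E] in tiles leaving [E] are among these. *)
Definition straddle P E : set S :=
  [set x | exists p q c : S, [/\ p \in P, q \in P, x = (p * c)%g & (q * c)%g \notin E]].

(* [x = p c] lies in [p E] up to few exceptions, and then [c] is in [E] by left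
   cancellation. *)
Lemma cnt_straddle P (eta : R) E : invariant P eta E ->
  cnt R E (straddle P E) <= 2 * fsize R P ^+ 2 * eta * fsize R E.
Proof.
move=> invE.
pose A p q := [set x | exists c : S, x = (p * c)%g /\ (q * c)%g \notin E].
have sA : cnt R E (straddle P E) <=
    cnt R E [set x | exists2 p, p \in P & [set y | exists2 q, q \in P & A p q y] x].
  apply: cnt_le => x _ [p [q [c [pP qP xpc qcE]]]].
  by exists p => //; exists q => //; exists c.
apply: (le_trans sA).
have bound p q : p \in P -> q \in P -> cnt R E (A p q) <= 2 * eta * fsize R E.
  move=> pP qP.
  apply: (@le_trans _ _ (cnt R E ([set y | ~ exists2 x, x \in E & y = (p * x)%g] `|`
     [set x | exists c, [/\ c \in E, x = (p * c)%g & (q * c)%g \notin E]]))).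
    apply: cnt_le => x _ [c [xpc qcE]].
    case: (pselect (exists2 x', x' \in E & x = (p * x')%g)) => [[x' x'E xpx']|]; last by left.
    by right; exists c; split => //; rewrite (@ltranslate_inj p c x') // -xpc.
  apply: le_trans (cntU _ _ _ _) _.
  rewrite -mulrA mulr_natl mulr2n lerD //.
    exact: le_trans (cnt_not_ltranslate _ _) (invE _ pP).
  apply: le_trans (invE _ qP).
  apply: (@cnt_le_image _ _ (fun c => (p * c)%g)) => x _ [c [cE xpc qcE]].
  by exists c.
have -> : 2 * fsize R P ^+ 2 * eta * fsize R E =
    fsize R P * (fsize R P * (2 * eta * fsize R E)) by ring.
by apply: cnt_exists => p pP; apply: cnt_exists => q qP; apply: bound.
Qed.

(** Union bound: at most [|K| del |E| < |E|] points of [E] are moved out of [E] by some element of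
    [K]. *)
Lemma exists_invariant_point K (del : R) E : E != fset0 -> fsize R K * del < 1 ->
  invariant K del E -> exists2 x, x \in E & forall s, s \in K -> (s * x)%g \in E.
Proof.
move=> E0 Kd invE; apply: contrapT => H.
have : fsize R E <= fsize R K * (del * fsize R E).
  rewrite -[leLHS]cntT; apply: le_trans (cnt_exists invE).
  apply: cnt_le => x xE _; apply: contrapT => H'; apply: H; exists x => // s sK.
  by case: (boolP ((s * x)%g \in E)) => // sx; case: H'; exists s.
by rewrite mulrA leNgt gtr_pMl ?Kd // fsize_gt0.
Qed.

(** For [x] as in [exists_invariant_point], right cancellation makes [s |-> s x] an injection of [K]
    into [E]. *)
Lemma invariant_large K (del : R) E : E != fset0 -> fsize R K * del < 1 ->
  invariant K del E -> fsize R K <= fsize R E.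
Proof.
move=> E0 Kd /(exists_invariant_point E0 Kd)[x xE xK].
by rewrite -!cntT; apply: (cnt_le_inj _ (@rtranslate_inj x)) => s /xK.
Qed.

Lemma invariant_rtranslate K (del : R) E (c : S) : invariant K del E ->
  invariant K del [fset (x * c)%g | x in E]%fset.
Proof.
move=> invE s sK; set Ec := [fset _ | _ in _]%fset.
have -> : fsize R Ec = fsize R E.
  by rewrite /fsize card_imfset //; exact: rtranslate_inj.
apply: le_trans (invE _ sK).
apply: (@cnt_le_image _ _ (fun x => (x * c)%g)) => _ /imfsetP[x /= xE ->] sxE.
exists x; split => //; apply: contra sxE => sxE.
by apply/imfsetP; exists (s * x)%g => //=; rewrite mulgA.
Qed.

Lemma folner_invariant (F : nat -> {fset S}) (K : {fset S}) (del : R) :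
  folner_sequence R F -> 0 < del ->
  exists n, forall N, (n <= N)%N -> invariant K del (F N).
Proof.
move=> [F0 FF] d0.
suff H : forall L : seq S, exists n, forall N, (n <= N)%N -> forall s, s \in L ->
    cnt R (F N) [set x | (s * x)%g \notin F N] <= del * fsize R (F N).
  by have [n Hn] := H K; exists n => N nN s; exact: Hn.
elim=> [|s L [n IH]]; first by exists 0%N.
have := FF s; move/cvgrPdist_lt => /(_ _ d0) [m _ Hm].
exists (maxn n m) => N; rewrite geq_max => /andP[nN mN] t.
rewrite inE => /predU1P[->|]; last exact: IH.
have := Hm _ mN; rewrite /= sub0r normrN ger0_norm ?divr_ge0 //.
rewrite ltr_pdivrMr; last by rewrite ltr0n cardfs_gt0.
move=> /ltW; apply: le_trans; rewrite /cnt ler_nat.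
set D := [fset x in F N | _]%fset.
have <- : #|` [fset (s * x)%g | x in D]%fset| = #|` D|.
  exact/card_imfset/ltranslate_inj.
apply/fsubset_leq_card/fsubsetP => _ /imfsetP[x /= + ->].
rewrite inE => /andP[xF /set_mem /= sxF].
by apply/fsetUP; right; apply/fsetDP; split => //; apply/imfsetP; exists x.
Qed.

End Invariance.

(** * Quasi-tilings *)

Section QuasiTilings.
Context (R : realType) (S : semigroupType).
Hypothesis S_cancel : cancellative S.
Hypothesis folner : forall (K : {fset S}) (del : R), 0 < del ->
  exists2 T : {fset S}, T != fset0 & invariant K del T.
Implicit Types (E K P T U V : {fset S}) (G : set ({fset S} * {fset S})).

(* In a pair [(V, U)], [U] is a full translate of a shape and [V] is the part of [U]
   that belongs to no other tile. *)
Record quasi_tiling P K (eps del : R) G : Prop := QuasiTiling {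
  qt_sub : forall p, G p -> (p.1 `<=` p.2)%fset;
  qt_big : forall p, G p -> (1 - eps) * fsize R p.2 <= fsize R p.1;
  qt_neq0 : forall p, G p -> p.2 != fset0;
  qt_inv : forall p, G p -> invariant K del p.2;
  qt_shape : forall p, G p ->
    exists c, forall x, x \in p.2 -> exists2 t, t \in P & x = (t * c)%g;
  qt_disj : forall p q x, G p -> G q -> x \in p.1 -> x \in q.1 -> p = q;
  qt_full : forall p x, G p -> x \in p.2 -> exists2 q, G q & x \in q.1
}.

Definition covered G : set S := [set x | exists2 p, G p & x \in p.1].

Lemma qt_le P K K' (eps del del' : R) G : (K' `<=` K)%fset -> del <= del' ->
  quasi_tiling P K eps del G -> quasi_tiling P K' eps del' G.
Proof.
move=> KK dd [*]; split => // p Gp.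
by apply: invariant_le KK dd _; auto.
Qed.

(* The boundary of the covered set is estimated with the full translates [U]: they
   are [del]-invariant with an arbitrarily small [del], while the parts [V] are only
   invariant up to [eps]. *)
Lemma qt_boundary P K (eps del eta : R) G E (s : S) :
  eps <= 2^-1 -> 0 <= del -> quasi_tiling P K eps del G ->
  s \in K -> invariant P eta E ->
  cnt R E [set x | [/\ ~ covered G x, covered G (s * x)%g & (s * x)%g \in E]]
  <= (2 * fsize R P ^+ 2 * eta + 2 * del) * fsize R E.
Proof.
move=> eps2 del0 qtG sK invE.
pose tiles := [fset p in (fpowerset E `*` fpowerset E)%fset | p \in G]%fset.
have tilesP p : p \in tiles -> G p /\ (p.2 `<=` E)%fset.
  by rewrite !inE !fpowersetE => /andP[/andP[_ ->] /set_mem].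
have tilesI p : G p -> (p.2 `<=` E)%fset -> p \in tiles.
  move=> Gp pE; rewrite !inE !fpowersetE pE mem_set // !andbT.
  exact: fsubset_trans (qt_sub qtG Gp) pE.
pose A (p : {fset S} * {fset S}) := [set y | y \in p.2 /\ ~ exists2 x, x \in p.2 & y = (s * x)%g].
(* Count [y = s x] instead of [x]; it lies in some [p.1]. Either [p.2] leaves [E] and [y] straddles,
   or [p.2] is inside [E]; then [x] is not in [p.2], since otherwise [qt_full] would make [x]
   covered. *)
apply: (@le_trans _ _ (cnt R E (straddle P E `|` [set y | exists2 p, p \in tiles & A p y]))).
  apply: (cnt_le_inj _ (@ltranslate_inj _ S_cancel s)) => x xE [ncx [p Gp sxp] sxE].
  split=> //.
  have sxp2 := fsubsetP (qt_sub qtG Gp) _ sxp.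
  case: (boolP (p.2 `<=` E)%fset) => [pE|].
    right; exists p; first exact: tilesI.
    split=> // -[x' x'p /(ltranslate_inj S_cancel)?]; subst x'; apply: ncx.
    by have [q Gq xq] := qt_full qtG Gp x'p; exists q.
  move=> /fsubsetPn[y yp yE]; left.
  have [c Hc] := qt_shape qtG Gp.
  have [t tP ->] := Hc _ sxp2; have [t' t'P yt'] := Hc _ yp.
  by exists t, t', c; split=> //; rewrite -yt'.
apply: le_trans (cntU _ _ _ _) _; rewrite mulrDl lerD //; first exact: cnt_straddle.
apply: le_trans (cnt_exists_sum _ _ _ _) _.
(* [eps <= 2^-1] gives [|U| <= 2 |V|], and the parts [V] inside [E] are disjoint, so the boundaries
   of the [U] add up to at most [2 del |E|]. *)
apply: (@le_trans _ _ (2 * del * \sum_(p <- tiles) fsize R p.1)).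
  rewrite mulr_sumr big_seq [leRHS]big_seq; apply: ler_sum => p /tilesP[Gp pE].
  apply: (@le_trans _ _ (del * fsize R p.2)).
    apply: (le_trans _ (qt_inv qtG Gp sK)).
    apply: (le_trans _ (cnt_not_ltranslate R S_cancel s p.2)).
    by apply: (@cnt_le_inj _ _ id) => // x xE [xp Hx].
  rewrite -mulrA mulrCA; apply: ler_wpM2l => //.
  have := qt_big qtG Gp; have := fsize_ge0 R p.2; nra.
apply: ler_wpM2l; first lra.
apply: sum_fsize_tiles => [p /tilesP[Gp pE]|p q x /tilesP[Gp _] /tilesP[Gq _]].
  exact: fsubset_trans (qt_sub qtG Gp) pE.
exact: (qt_disj qtG).
Qed.

(** Zorn's lemma yields a maximal family of added pairs. If less than a fraction [eps] of some [T c]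
    were covered, the uncovered part of [T c], paired with [T c], could still be added. *)
Lemma qt_extend P K T (eps del : R) G : 0 < eps < 1 -> 0 <= del ->
  quasi_tiling P K eps del G -> T != fset0 -> invariant K del T ->
  exists G', [/\ quasi_tiling (P `|` T)%fset K eps del G',
    covered G `<=` covered G' &
    forall c, eps * fsize R T <= cnt R T [set t | covered G' (t * c)%g]].
Proof.
move=> /andP[eps0 eps1] del0 qtG T0 invT.
pose valid X := quasi_tiling (P `|` T)%fset K eps del (G `|` X).
have valid0 : valid set0.
  rewrite /valid setU0; split; [exact: qt_sub qtG|exact: qt_big qtG|
    exact: qt_neq0 qtG|exact: qt_inv qtG| |exact: qt_disj qtG|exact: qt_full qtG].
  move=> p Gp; have [c Hc] := qt_shape qtG Gp; exists c => x /Hc[t tP ->].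
  by exists t; rewrite // inE tP.
have [F Fv Ftot|X [vX maxX]] := @Zorn_bigcup _ valid.
  (* Each clause concerns at most two given pairs, and these lie in [G] together with a single
     member of the chain. For two pairs of [G] the set [set0] serves, which also settles the empty
     chain. *)
  have common p q : (G `|` \bigcup_(X in F) X) p -> (G `|` \bigcup_(X in F) X) q ->
      exists X, [/\ valid X, X `<=` \bigcup_(X in F) X, (G `|` X) p & (G `|` X) q].
    move=> [Gp|[X FX Xp]] [Gq|[Y FY Yq]].
    - by exists set0; split => //; left.
    - exists Y; split; [exact: Fv|exact: bigcup_sup|by left|by right].
    - exists X; split; [exact: Fv|exact: bigcup_sup|by right|by left].
    - case: (Ftot _ _ FX FY) => XY.
        by exists Y; split; [exact: Fv|exact: bigcup_sup|right; exact: XY|by right].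
      by exists X; split; [exact: Fv|exact: bigcup_sup|by right|right; exact: XY].
  split.
  - by move=> p Gp; have [X [vX _ Xp _]] := common p p Gp Gp; exact: (qt_sub vX).
  - by move=> p Gp; have [X [vX _ Xp _]] := common p p Gp Gp; exact: (qt_big vX).
  - by move=> p Gp; have [X [vX _ Xp _]] := common p p Gp Gp; exact: (qt_neq0 vX).
  - by move=> p Gp; have [X [vX _ Xp _]] := common p p Gp Gp; exact: (qt_inv vX).
  - by move=> p Gp; have [X [vX _ Xp _]] := common p p Gp Gp; exact: (qt_shape vX).
  - move=> p q x Gp Gq; have [X [vX _ Xp Xq]] := common p q Gp Gq.
    exact: (qt_disj vX).
  - move=> p x Gp xp; have [X [vX XF Xp _]] := common p p Gp Gp.
    have [q Xq xq] := qt_full vX Xp xp; exists q => //.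
    by case: Xq => [|/XF]; [left|right].
exists (G `|` X); split => // [x [p Gp xp]|c]; first by exists p => //; left.
rewrite leNgt; apply/negP => small.
pose Q := covered (G `|` X).
pose U := [fset (t * c)%g | t in T]%fset.
pose V := [fset x in U | x \in ~` Q]%fset.
have UT : fsize R U = fsize R T.
  by rewrite /fsize card_imfset //; exact: rtranslate_inj.
have VU : (V `<=` U)%fset by apply/fsubsetP => x /in_fset_setP[].
have U0 : U != fset0.
  have [t tT] := fset0Pn _ T0; apply/fset0Pn; exists (t * c)%g.
  by apply/imfsetP; exists t.
have VQ x : x \in V -> ~ Q x by move=> /in_fset_setP[].
have UVQ x : x \in U -> ~ Q x -> x \in V.
  by move=> xU xQ; apply/in_fset_setP.
have bigV : (1 - eps) * fsize R U <= fsize R V.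
  have -> : fsize R V = cnt R U (~` Q) by [].
  rewrite cntC mulrBl mul1r lerD2l lerN2 UT; apply: le_trans (ltW small).
  apply: (@cnt_le_image _ _ (fun t => (t * c)%g)) => _ /imfsetP[t /= tT ->] Qtc.
  by exists t.
(* [V] is nonempty because [eps < 1]; hence [(V, U)] is not yet in [X] and contradicts maximality
   once adding it is shown valid. *)
have [x0 x0V] : exists x, x \in V.
  apply/fset0Pn; rewrite -cardfs_gt0 -(ltr0n R); apply: lt_le_trans bigV.
  by rewrite mulr_gt0 ?fsize_gt0 // subr_gt0.
have newV p x : (G `|` X) p -> x \in V -> x \notin p.1.
  by move=> Gp /VQ xQ; apply/negP => xp; apply: xQ; exists p.
have nXV : ~ X (V, U).
  by move=> XVU; have := @newV (V, U) x0 (or_intror XVU) x0V; rewrite /= x0V.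
apply: (maxX (X `|` [set (V, U)])).
  by split; [exact: subsetUl|move=> /(_ (V, U) (or_intror erefl))].
have old p : (G `|` (X `|` [set (V, U)])) p -> (G `|` X) p \/ p = (V, U).
  by case=> [|[|->]]; [left; left|left; right|right].
have oldI p : (G `|` X) p -> (G `|` (X `|` [set (V, U)])) p.
  by case; [left|right; left].
split.
- by move=> p /old[/(qt_sub vX)|->].
- by move=> p /old[/(qt_big vX)|->].
- by move=> p /old[/(qt_neq0 vX)|->].
- by move=> p /old[/(qt_inv vX)|->] //; exact: invariant_rtranslate.
- move=> p /old[/(qt_shape vX)|->] //; exists c => _ /imfsetP[t /= tT ->].
  by exists t; rewrite // inE tT orbT.
- move=> p q x /old[Gp|->] /old[Gq|->] //=.
  + exact: (qt_disj vX).
  + by move=> xp xV; have := newV _ _ Gp xV; rewrite xp.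
  + by move=> xV xq; have := newV _ _ Gq xV; rewrite xq.
- move=> p x /old[Gp xp|-> /= xU].
    by have [q Gq xq] := qt_full vX Gp xp; exists q => //; exact: oldI.
  case: (pselect (Q x)) => [[q Gq xq]|xQ]; first by exists q => //; exact: oldI.
  by exists (V, U); [right; right|exact: UVQ].
Qed.

(* The new shape [T] is chosen before the shapes of the induction hypothesis, which
   are then taken [T]-invariant: thus the uncovered part of [E] is [T]-invariant too,
   and the translates of [T] cover a proportion [eps / 2] of it. *)
Lemma qt_exists (eps : R) : 0 < eps <= 2^-1 ->
  forall n K (del : R), 0 < del -> exists P G, quasi_tiling P K eps del G /\
    exists K' (del' : R), 0 < del' /\ forall E, invariant K' del' E ->
      cnt R E (~` covered G) <= Num.max ((1 - eps / 2) ^+ n) del * fsize R E.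
Proof.
move=> /andP[eps0 eps2]; elim=> [|n IH] K del del0.
  exists fset0, set0; split; first by split.
  exists fset0, 1; split=> // E _.
  apply: (le_trans (cnt_le_fsize _ _ _)).
  by rewrite -[leLHS]mul1r ler_wpM2r ?fsize_ge0 // expr0 le_max lexx.
have [T T0 invT] := folner K del0.
(* Chosen so that [eta * c + 2 * del1 <= eps / 2 * del] below: each [t] in [T] then moves at most a
   fraction [eps / 2] of the uncovered part [E'] out of [E']. *)
pose del1 := del * eps / 8.
have del10 : 0 < del1 by rewrite /del1 !mulr_gt0.
have [P [G [qtG [K1 [del' [del'0 covG]]]]]] := IH (K `|` T)%fset del1 del10.
have eps1 : 0 < eps < 1 by apply/andP; split; lra.
have del1del : del1 <= del by rewrite /del1; nra.
have qtGK : quasi_tiling P K eps del G by apply: qt_le qtG => //; exact: fsubsetUl.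
have [G' [qtG' GG' covT]] := qt_extend eps1 (ltW del0) qtGK T0 invT.
exists (P `|` T)%fset, G'; split => //.
pose c := 1 + 2 * fsize R P ^+ 2.
have c0 : 0 < c by rewrite /c; have := sqr_ge0 (fsize R P); lra.
pose eta := Num.min del' (del * eps / 4 / c).
have eta0 : 0 < eta by rewrite lt_min del'0 !divr_gt0 ?mulr_gt0.
have etac : eta * c <= del * eps / 4 by rewrite -ler_pdivlMr // ge_min lexx orbT.
exists (K1 `|` (P `|` T))%fset, eta; split=> // E invE.
have invK1 : invariant K1 del' E.
  by apply: invariant_le invE; [exact: fsubsetUl|rewrite ge_min lexx].
have invP : invariant P eta E.
  by apply: invariant_le invE => //; apply/fsubsetP => x; rewrite !inE => ->; rewrite orbT.
have invTE : invariant T eta E.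
  by apply: invariant_le invE => //; apply/fsubsetP => x; rewrite !inE => ->; rewrite !orbT.
pose E' := [fset x in E | x \in ~` covered G]%fset.
have E'E x : x \in E' -> x \in E by move=> /in_fset_setP[].
have E'Q x : x \in E' -> ~ covered G x by move=> /in_fset_setP[].
have E'I x : x \in E -> ~ covered G x -> x \in E'.
  by move=> xE xQ; apply/in_fset_setP.
have GE' : cnt R E (~` covered G') <= cnt R E' (~` covered G').
  apply: (@cnt_le_inj _ _ id) => // x xE xG'; split=> //.
  by apply: E'I => // /GG'.
apply: (le_trans GE').
have sE' : fsize R E' = cnt R E (~` covered G) by [].
have max0 : 0 <= Num.max ((1 - eps / 2) ^+ n.+1) del by rewrite le_max (ltW del0) orbT.
(* A small uncovered part is absorbed by the maximum. Otherwise errors relative to [|E|] become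
   errors relative to [|E'|]. *)
case: (leP (fsize R E') (del * fsize R E)) => [small|big].
  apply: (le_trans (cnt_le_fsize _ _ _)); apply: (le_trans small).
  by apply: ler_wpM2r; rewrite ?fsize_ge0 // le_max lexx orbT.
have sizeE := fsize_ge0 R E.
have E'n : fsize R E' <= (1 - eps / 2) ^+ n * fsize R E.
  have := covG E invK1; rewrite -sE'; case: (leP ((1 - eps / 2) ^+ n) del1) => // _ H.
  have : del1 * fsize R E <= del * fsize R E by exact: ler_wpM2r.
  by move=> /(le_trans H) /(lt_le_trans big); rewrite ltxx.
have escape t : t \in T -> cnt R E' [set x | (t * x)%g \notin E'] <= eps / 2 * fsize R E'.
  move=> tT.
  apply: (@le_trans _ _ (cnt R E ([set x | (t * x)%g \notin E] `|`
      [set x | [/\ ~ covered G x, covered G (t * x)%g & (t * x)%g \in E]]))).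
    apply: (@cnt_le_inj _ _ id) => // x xE' /negP txE'; split; first exact: E'E.
    case: (boolP ((t * x)%g \in E)) => [txE|]; last by left.
    right; split => //; first exact: E'Q.
    by apply: contrapT => /(E'I _ txE).
  apply: (le_trans (cntU _ _ _ _)).
  have tKT : t \in (K `|` T)%fset by rewrite inE tT orbT.
  have := qt_boundary eps2 (ltW del10) qtG tKT invP.
  have := invTE _ tT.
  set a := cnt _ _ _; set b := cnt _ _ _ => Ha Hb.
  apply: (@le_trans _ _ ((eta * c + 2 * del1) * fsize R E)); first by rewrite /c; lra.
  apply: (@le_trans _ _ (eps / 2 * (del * fsize R E))).
    rewrite mulrA; apply: ler_wpM2r => //; rewrite /del1; lra.
  by apply: ler_wpM2l; [lra|exact: ltW].
have sizeT : 0 < fsize R T by exact: fsize_gt0.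
(* Double count the pairs [(t, x)] in [T] and [E'] with [t x] covered by [G']. Each [x] gives at
   least [eps |T|] of them; each [t] gives at most the number of covered points of [E'] plus the
   number of points it moves out of [E']. *)
have : fsize R T * (eps * fsize R E') <=
    fsize R T * (cnt R E' (covered G') + eps / 2 * fsize R E').
  apply: (@le_trans _ _ (\sum_(x <- E') cnt R T [set t | covered G' (t * x)%g])).
    rewrite mulrCA [X in eps * X]mulrC.
    rewrite mulrCA [X in X * _]fsize_sum mulr_suml.
    by apply: ler_sum => x _; rewrite mul1r.
  under eq_bigr do rewrite cnt_sum.
  rewrite exchange_big /= [X in X * _]fsize_sum mulr_suml big_seq [leRHS]big_seq.
  apply: ler_sum => t tT; rewrite mul1r.
  have -> : \sum_(x <- E') (t \in [set t | covered G' (t * x)%g])%:R =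
      cnt R E' [set x | covered G' (t * x)%g].
    by rewrite cnt_sum; apply: eq_bigr.
  apply: (@le_trans _ _ (cnt R E' ([set x | (t * x)%g \in E' /\ covered G' (t * x)%g] `|`
      [set x | (t * x)%g \notin E']))).
    by apply: cnt_le => x _ txG'; case: (boolP ((t * x)%g \in E')); [left|right].
  apply: (le_trans (cntU _ _ _ _)); apply: lerD (escape t tT).
  by apply: (cnt_le_inj _ (@ltranslate_inj _ S_cancel t)) => x _ [].
rewrite ler_pM2l // => H.
apply: (@le_trans _ _ ((1 - eps / 2) * fsize R E')); first by rewrite cntC; lra.
apply: (@le_trans _ _ ((1 - eps / 2) ^+ n.+1 * fsize R E)).
  by rewrite exprS -mulrA; apply: ler_wpM2l => //; lra.
by apply: ler_wpM2r => //; rewrite le_max lexx.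
Qed.

(** Only the disjoint parts [V] are kept. [P] bounds the size of the tiles, and [K'], [del'] say how
    invariant [E] must be for the tiles inside [E] to fill it up to a fraction [del]. *)
Record tiling P K (del : R) (VV : set {fset S}) K' (del' : R) : Prop := Tiling {
  tl_neq0 : forall V, VV V -> V != fset0;
  tl_inv : forall V, VV V -> invariant K del V;
  tl_shape : forall V, VV V ->
    exists c, forall x, x \in V -> exists2 t, t \in P & x = (t * c)%g;
  tl_disj : forall V W x, VV V -> VV W -> x \in V -> x \in W -> V = W;
  tl_cover : forall E, invariant K' del' E ->
    cnt R E [set x | ~ exists V, [/\ VV V, x \in V & (V `<=` E)%fset]]
      <= del * fsize R E
}.

Lemma exists_tiling K (del : R) : 0 < del ->
  exists P VV K' del', 0 < del' /\ tiling P K del VV K' del'.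
Proof.
move=> del0; pose eps : R := Num.min 2^-1 (del / 4).
have eps0 : 0 < eps by rewrite lt_min divr_gt0 // invr_gt0 ltr0n.
have eps2 : eps <= 2^-1 by rewrite ge_min lexx.
have epsd : eps <= del / 4 by rewrite ge_min lexx orbT.
have [n Hn] : exists n, (1 - eps / 2) ^+ n <= del / 4.
  have : `|1 - eps / 2| < 1 by rewrite ger0_norm; lra.
  move=> /cvg_expr /cvgrPdist_lt /(_ (del / 4)) [|n _ /(_ n (leqnn n))]; first lra.
  rewrite /= sub0r normrN => H; exists n.
  exact: le_trans (ler_norm _) (ltW H).
have del40 : 0 < del / 4 by lra.
have eps02 : 0 < eps <= 2^-1 by rewrite eps0.
have [P [G [qtG [K1 [del1 [del10 covG]]]]]] := qt_exists eps02 n K del40.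
have VU p : G p -> fsize R p.2 <= 2 * fsize R p.1.
  move=> Gp; have := qt_big qtG Gp; have := fsize_ge0 R p.2; nra.
pose c := 1 + 2 * fsize R P ^+ 2.
have c0 : 0 < c by rewrite /c; have := sqr_ge0 (fsize R P); lra.
pose eta := Num.min del1 (del / 2 / c).
have eta0 : 0 < eta by rewrite lt_min del10 !divr_gt0.
have etac : eta * c <= del / 2 by rewrite -ler_pdivlMr // ge_min lexx orbT.
exists P, [set p.1 | p in G], (K1 `|` P)%fset, eta; split => //; split.
- move=> _ [p Gp <-]; rewrite -cardfs_gt0 -(ltr0n R).
  have := VU _ Gp; have := fsize_gt0 R (qt_neq0 qtG Gp); rewrite /fsize; lra.
- move=> _ [p Gp <-] s sK.
  (* A point of [V] leaves [V] either by leaving [U] or by landing in [U \ V], which has at most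
     [eps |U|] points. *)
  apply: (@le_trans _ _ (cnt R p.2 ([set x | (s * x)%g \notin p.2]) +
     cnt R p.2 (~` [set x | x \in p.1]))).
    apply: (@le_trans _ _ (cnt R p.1 ([set x | (s * x)%g \notin p.2] `|`
      [set x | (s * x)%g \in p.2 /\ (s * x)%g \notin p.1]))).
      apply: cnt_le => x xp sxp.
      by case: (boolP ((s * x)%g \in p.2)); [right|left].
    apply: (le_trans (cntU _ _ _ _)); apply: lerD.
      exact/cnt_sub/(qt_sub qtG).
    by apply: (cnt_le_inj _ (@ltranslate_inj _ S_cancel s)) => x _ [? /negP].
  have := qt_inv qtG Gp sK.
  have : cnt R p.2 (~` [set x | x \in p.1]) <= eps * fsize R p.2.
    rewrite cntC.
    have -> : cnt R p.2 [set x | x \in p.1] = fsize R p.1.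
      rewrite /cnt /fsize; congr (_%:R); congr #|` _|.
      apply/fsetP => x; apply/in_fset_setP/idP => [[]//|xp]; split => //.
      exact: (fsubsetP (qt_sub qtG Gp)).
    by have := qt_big qtG Gp; lra.
  set a := cnt _ _ _; set b := cnt _ _ _.
  have := VU _ Gp; have := fsize_ge0 R p.2; nra.
- move=> _ [p Gp <-]; have [a Ha] := qt_shape qtG Gp; exists a => x xp.
  exact/Ha/(fsubsetP (qt_sub qtG Gp)).
- by move=> _ _ x [p Gp <-] [q Gq <-] xp xq; rewrite (qt_disj qtG Gp Gq xp xq).
- move=> E invE.
  apply: (@le_trans _ _ (cnt R E (~` covered G `|` straddle P E))).
    apply: cnt_le => x xE nV; case: (pselect (covered G x)) => [[p Gp xp]|]; last by left.
    right; have [y yp yE] : exists2 y, y \in p.1 & y \notin E.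
      by apply/fsubsetPn/negP => pE; apply: nV; exists p.1; split => //; exists p.
    have [a Ha] := qt_shape qtG Gp.
    have [t tP xt] := Ha _ (fsubsetP (qt_sub qtG Gp) _ xp).
    have [t' t'P yt'] := Ha _ (fsubsetP (qt_sub qtG Gp) _ yp).
    by exists t, t', a; rewrite -xt -yt'; split.
  apply: (le_trans (cntU _ _ _ _)).
  have H1 : cnt R E (~` covered G) <= del / 4 * fsize R E.
    rewrite -[X in _ <= X * _](max_r Hn); apply: covG.
    by apply: invariant_le invE; [exact: fsubsetUl|rewrite ge_min lexx].
  have H2 : cnt R E (straddle P E) <= 2 * fsize R P ^+ 2 * eta * fsize R E.
    by apply: cnt_straddle => //; apply: invariant_le invE => //; exact: fsubsetUr.
  have : 2 * fsize R P ^+ 2 * eta * fsize R E <= del / 2 * fsize R E.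
    apply: ler_wpM2r; first exact: fsize_ge0.
    by apply: le_trans etac; rewrite /c; lra.
  have := mulr_ge0 (ltW del0) (fsize_ge0 R E).
  lra.
Qed.

End QuasiTilings.

(** * Balancing averages *)

Section Averages.
Context (R : realType) (d : measure_display) (X : measurableType d).
Context (mu : probability X R).

Local Notation pr A := (fine (mu A)).

Lemma pr_split (Y E : set X) : measurable Y -> measurable E ->
  pr Y = pr (E `&` Y) + pr (~` E `&` Y).
Proof.
move=> mY mE.
have fin (A : set X) : measurable A -> mu A \is a fin_num by move=> mA; exact: fin_num_measure.
have mEY : measurable (E `&` Y) by exact: measurableI.
have mCY : measurable (~` E `&` Y) by apply: measurableI => //; exact: measurableC.
rewrite -fineD; [|exact: fin|exact: fin].
rewrite -measureU //; first by rewrite -setIUl setUv setTI.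
by rewrite setIACA setICr set0I.
Qed.

(** A lower bound for the integral of a simple function over [Y], without integrals: induction on
    [s] cuts [Y] along [E i], and on [E i] the bound [c] becomes [c - a i]. *)
Lemma sum_indic_mean (I : Type) (s : seq I) (a : I -> R) (E : I -> set X) :
  (forall i, measurable (E i)) ->
  forall (Y : set X) (c : R), measurable Y ->
  (forall x, Y x -> c <= \sum_(i <- s) a i * \1_(E i) x) ->
  c * pr Y <= \sum_(i <- s) a i * pr (E i `&` Y).
Proof.
move=> mE; elim: s => [|i s IH] Y c mY Hc.
  rewrite big_nil; have [->|/set0P[x Yx]] := eqVneq Y set0.
    by rewrite measure0 mulr0.
  by have := Hc x Yx; rewrite big_nil => c0; rewrite mulr_le0_ge0 // fine_ge0.
have mY1 : measurable (E i `&` Y) by exact: measurableI.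
have mY2 : measurable (~` E i `&` Y) by apply: measurableI => //; exact: measurableC.
have H1 := IH _ (c - a i) mY1; have H2 := IH _ c mY2.
rewrite big_cons.
have -> : \sum_(j <- s) a j * pr (E j `&` Y) =
    \sum_(j <- s) a j * pr (E j `&` (E i `&` Y)) +
    \sum_(j <- s) a j * pr (E j `&` (~` E i `&` Y)).
  rewrite -big_split /=; apply: eq_bigr => j _; rewrite -mulrDr; congr (_ * _).
  rewrite (@pr_split (E j `&` Y) (E i)) //; last exact: measurableI.
  by rewrite !(setICA (E j)).
have := pr_split mY (mE i).
have : (c - a i) * pr (E i `&` Y) <= \sum_(j <- s) a j * pr (E j `&` (E i `&` Y)).
  apply: H1 => x [Eix Yx]; have := Hc x Yx.
  by rewrite big_cons indicE mem_set // mulr1 lerBlDl.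
have : c * pr (~` E i `&` Y) <= \sum_(j <- s) a j * pr (E j `&` (~` E i `&` Y)).
  apply: H2 => x [Eix Yx]; have := Hc x Yx.
  by rewrite big_cons indicE memNset // mulr0 add0r.
move=> + + ->; lra.
Qed.

(* The slack [1] absorbs the strictness of the inequality at the single points. *)
Lemma sum_indic_le_mean (I : Type) (s : seq I) (a : I -> R) (E : I -> set X) :
  (forall i, measurable (E i)) ->
  exists x, \sum_(i <- s) a i * (\1_(E i) x - pr (E i)) <= 1.
Proof.
move=> mE; apply: contrapT => H.
have := @sum_indic_mean I s a E mE setT (1 + \sum_(i <- s) a i * pr (E i)) measurableT.
have -> : pr setT = 1 by rewrite probability_setT.
rewrite mulr1; have -> : \sum_(i <- s) a i * pr (E i `&` setT) = \sum_(i <- s) a i * pr (E i).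
  by apply: eq_bigr => i _; rewrite setIT.
suff H' : forall x, setT x ->
    1 + \sum_(i <- s) a i * pr (E i) <= \sum_(i <- s) a i * \1_(E i) x.
  by move=> /(_ H'); lra.
move=> x _; rewrite leNgt; apply/negP => lt1; apply: H; exists x.
under eq_bigr do rewrite mulrBr.
by rewrite sumrB; lra.
Qed.

Lemma exists_point : exists x : X, True.
Proof.
have [x _] := @sum_indic_le_mean unit [::] (fun=> 0) (fun=> setT) (fun=> measurableT).
by exists x.
Qed.

(* Greedy choice: the next point is chosen so that its deviation vector has almost
   nonpositive scalar product with the sum of the previous ones, hence the squared
   norms add up. *)
Lemma greedy_balance (I J : choiceType) (js : seq J) (s : seq I)
    (dev : I -> X -> J -> R) (b : I -> R) :
  uniq s -> (forall i, i \in s -> 1 <= b i) ->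
  (forall i x j, i \in s -> `|dev i x j| <= b i) ->
  (forall i (w : J -> R), i \in s -> exists x, \sum_(j <- js) w j * dev i x j <= 1) ->
  exists xi : I -> X, \sum_(j <- js) (\sum_(i <- s) dev i (xi i) j) ^+ 2 <=
    ((size js)%:R + 2) * \sum_(i <- s) b i ^+ 2.
Proof.
elim: s => [_ _ _ _|i s IH /= /andP[nis us] b1 devb sel].
  have [x _] := exists_point; exists (fun=> x).
  rewrite [X in _ * X]big_nil mulr0 big1 // => j _; by rewrite big_nil expr0n.
have ins k : k \in s -> k \in i :: s by rewrite inE => ->; rewrite orbT.
have [xi Hxi] := IH us (fun k ks => b1 k (ins k ks))
  (fun k x j ks => devb k x j (ins k ks)) (fun k w ks => sel k w (ins k ks)).
(* The weights are the current partial sums, so that the cross term of the new squares is at most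
   [2]. As [1 <= b i], this costs [2 * b i ^+ 2], whence the factor [size js + 2]. *)
have [x Hx] := sel i (fun j => \sum_(k <- s) dev k (xi k) j) (mem_head _ _).
exists (fun k => if k == i then x else xi k).
have -> : \sum_(j <- js) (\sum_(k <- i :: s) dev k (if k == i then x else xi k) j) ^+ 2 =
    \sum_(j <- js) (\sum_(k <- s) dev k (xi k) j) ^+ 2 +
    2 * \sum_(j <- js) (\sum_(k <- s) dev k (xi k) j) * dev i x j +
    \sum_(j <- js) dev i x j ^+ 2.
  rewrite mulr_sumr -!big_split /=; apply: eq_bigr => j _.
  rewrite big_cons eqxx.
  have -> : \sum_(k <- s) dev k (if k == i then x else xi k) j =
      \sum_(k <- s) dev k (xi k) j.
    rewrite big_seq [RHS]big_seq; apply: eq_bigr => k ks.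
    by case: eqP => // ki; rewrite -ki ks in nis.
  ring.
rewrite [in leRHS]big_cons [leRHS]mulrDr.
have sq : \sum_(j <- js) dev i x j ^+ 2 <= (size js)%:R * b i ^+ 2.
  rewrite -sum1_size natr_sum mulr_suml; apply: ler_sum => j _.
  have := devb i x j (mem_head _ _); rewrite mul1r ler_norml => /andP[]; nra.
have b2 : 1 <= b i ^+ 2 by rewrite exprn_ege1 // b1 ?mem_head.
lra.
Qed.

End Averages.

(** * Uniform approximation of pattern frequencies *)

Section Deviations.
Context (R : realType) (S : semigroupType).
Implicit Types (E V P K : {fset S}) (A : set S) (VV : set {fset S}).

(** Left unnormalized so as to be additive over disjoint tiles. *)
Definition deviation E A (m : R) : R := cnt R E A - m * fsize R E.

Lemma deviation_sum E A m : deviation E A m = \sum_(x <- E) ((x \in A)%:R - m).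
Proof.
rewrite /deviation cnt_sum fsize_sum mulr_sumr -sumrB.
by apply: eq_bigr => x _; rewrite mulr1.
Qed.

Lemma deviation_cnt E A A' D m : (forall x, x \in E -> ~ D x -> A x <-> A' x) ->
  `|deviation E A m - deviation E A' m| <= cnt R E D.
Proof.
move=> AA'; rewrite /deviation opprD addrACA subrr addr0.
have H (C C' : set S) : (forall x, x \in E -> ~ D x -> C x -> C' x) ->
    cnt R E C <= cnt R E C' + cnt R E D.
  move=> CC'; apply: le_trans (cntU _ _ _ _); apply: cnt_le => x xE Cx.
  by case: (pselect (D x)) => [|/(CC' x xE)]; [right|left; auto].
have H1 : cnt R E A <= cnt R E A' + cnt R E D by apply: H => x xE /(AA' x xE)[].
have H2 : cnt R E A' <= cnt R E A + cnt R E D by apply: H => x xE /(AA' x xE)[].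
by rewrite ler_norml; apply/andP; split; lra.
Qed.

Definition tiles_in VV E := [fset V in fpowerset E | V \in VV]%fset.

Lemma tiles_inP VV E V : reflect ((V `<=` E)%fset /\ VV V) (V \in tiles_in VV E).
Proof.
apply: (iffP (in_fset_setP _ _ _)) => -[]; first by rewrite fpowersetE.
by move=> VE; split => //; rewrite fpowersetE.
Qed.

Section Tiling.
Context (P K K' : {fset S}) (del del' : R) (VV : set {fset S}).
Hypothesis tl : tiling P K del VV K' del'.

Lemma sum_fsize_tiles_in E : \sum_(V <- tiles_in VV E) fsize R V <= fsize R E.
Proof.
apply: sum_fsize_tiles => [V /tiles_inP[]//|V W x /tiles_inP[_ VV1] /tiles_inP[_ VV2]].
exact: (tl_disj tl).
Qed.

(** Each point of [E] outside the tiles contained in [E] contributes at most [1] in absolute value,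
    because [m] lies in [[0, 1]]. *)
Lemma deviation_tiles E A m : 0 <= m <= 1 -> invariant K' del' E ->
  `|deviation E A m - \sum_(V <- tiles_in VV E) deviation V A m| <= del * fsize R E.
Proof.
move=> /andP[m0 m1] invE; rewrite deviation_sum.
under [X in _ - X]eq_bigr do rewrite deviation_sum.
rewrite (@sum_tiles _ _ _ (tiles_in VV E) id E); last 2 first.
- by move=> V /tiles_inP[].
- by move=> V W x /tiles_inP[_ VV1] /tiles_inP[_ VV2]; exact: (tl_disj tl).
rewrite addrAC subrr add0r; apply: le_trans (tl_cover tl invE).
apply: (le_trans (ler_norm_sum _ _ _)).
apply: (@le_trans _ _ (cnt R E [set x | forall i, i \in tiles_in VV E -> x \notin i])).
  rewrite cnt_sum; apply: ler_sum => x _; rewrite normrM normr_nat.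
  rewrite -[leRHS]mulr1; apply: ler_wpM2l => //.
  by rewrite ler_norml; case: (x \in A); apply/andP; split; rewrite /=; lra.
apply: cnt_le => x xE H [V [VVV xV VE]].
have VE' : V \in tiles_in VV E by apply/tiles_inP.
by have := H V VE'; rewrite xV.
Qed.

Lemma fsize_tile_le V : VV V -> fsize R V <= fsize R P.
Proof.
move=> VVV; have [c Hc] := tl_shape tl VVV.
rewrite -!cntT; apply: (@cnt_le_image _ _ (fun t => (t * c)%g)) => x /Hc[t tP ->] _.
by exists t.
Qed.

Lemma fsize_tile_ge1 V : VV V -> 1 <= fsize R V.
Proof. by move=> /(tl_neq0 tl); rewrite -cardfs_gt0 /fsize ler1n. Qed.

End Tiling.

(** The intersection of the [h^{-1} A] for [h] in [I], whose density is sought. *)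
Definition pattern (I : {fset S}) A : set S :=
  [set g | forall h, h \in I -> A (h * g)%g].

End Deviations.

(** * Sets with nearly correct frequencies, from orbits copied onto two scales of tiles *)

Section UniformApproximation.
Context (R : realType) (S : semigroupType).
Hypothesis S_cancel : cancellative S.
Hypothesis S_infinite : infinite_set [set: S].
Hypothesis folner : forall (K : {fset S}) (del : R), 0 < del ->
  exists2 T : {fset S}, T != fset0 & invariant K del T.
Context (d : measure_display) (X : measurableType d) (mu : probability X R).
Context (T : S -> X -> X) (B : set X).
Hypothesis T_mps : measure_preserving_action mu T.
Hypothesis mB : measurable B.

Definition event (I : {fset S}) : set X := [set x | forall h, h \in I -> B (T h x)].

Local Notation pr A := (fine (mu A)).

Lemma measurable_preimage_action s (C : set X) : measurable C -> measurable (T s @^-1` C).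
Proof.
by move=> mC; case: T_mps => mT _ _; have := mT s measurableT _ mC; rewrite setTI.
Qed.

Lemma measurable_event I : measurable (event I).
Proof.
have -> : event I = \bigcap_(h in [set` I]) (T h @^-1` B) by [].
apply: fin_bigcap_measurable => // h _; exact: measurable_preimage_action.
Qed.

Lemma pr_event01 I : 0 <= pr (event I) <= 1.
Proof.
rewrite fine_ge0 //= -[leRHS]/(fine 1%E) fine_le //.
- by apply: fin_num_measure; exact: measurable_event.
- exact/probability_le1/measurable_event.
Qed.

(** Every [T (co g)] preserves [mu], so the weighted sum has mean zero in [x], whatever [w] and [co]
    are. *)
Lemma select_point (V : {fset S}) (co : S -> S) (Is : seq {fset S}) (w : {fset S} -> R) :
  exists x, \sum_(I <- Is) w I *
    deviation V [set g | event I (T (co g) x)] (pr (event I)) <= 1.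
Proof.
have mE (i : {fset S} * S) : measurable (T (co i.2) @^-1` event i.1).
  exact/measurable_preimage_action/measurable_event.
have [x Hx] := sum_indic_le_mean mu [seq (J, g) | J <- Is, g <- V] (fun i => w i.1) mE.
exists x; apply: le_trans Hx; rewrite big_allpairs /=.
apply: ler_sum => I _; rewrite deviation_sum mulr_sumr; apply: ler_sum => g _.
case: T_mps => _ mpT _; rewrite mpT; last exact: measurable_event.
by rewrite indicE.
Qed.

Lemma uniform_approximation (H : {fset S}) (eps : R) : 0 < eps ->
  exists A K (del : R), 0 < del /\ forall E, invariant K del E ->
    forall I, (I `<=` H)%fset ->
    `|deviation E (pattern I A) (pr (event I))| <= eps * fsize R E.
Proof.
move=> eps0; pose e1 := eps / 4; have e10 : 0 < e1 by rewrite divr_gt0.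
pose cH := 1 + fsize R H; have cH0 : 0 < cH by rewrite /cH; have := fsize_ge0 R H; lra.
pose delV := e1 / cH; have delV0 : 0 < delV by rewrite divr_gt0.
have delVH : fsize R H * delV <= e1.
  have : cH * delV = e1 by rewrite mulrC divfK // gt_eqF.
  by rewrite /cH; nra.
have delVe : delV <= e1.
  have : cH * delV = e1 by rewrite mulrC divfK // gt_eqF.
  by rewrite /cH; have := fsize_ge0 R H; nra.
have [P [VV [KV [delV' [delV'0 tlV]]]]] := exists_tiling S_cancel folner H delV0.
pose Is : seq {fset S} := fpowerset H.
pose D : R := (size Is)%:R + 2; have D0 : 0 < D by rewrite /D ltr_wpDl.
(* Makes [D |P| |W| <= (e1 |W|)^2] as soon as [M <= |W|]; the greedy choice then leaves a deviation
   of at most [e1 |W|]. *)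
pose M := D * fsize R P / e1 ^+ 2.
have [L _ LM] := infinite_set_fset (Num.bound M) S_infinite.
have ML : M <= fsize R L.
  have M0 : 0 <= M by rewrite /M !mulr_ge0 ?fsize_ge0 ?invr_ge0 ?sqr_ge0 // ltW.
  by rewrite (le_trans (ltW (archi_boundP M0))) // ler_nat.
pose cL := 1 + fsize R L; have cL0 : 0 < cL by rewrite /cL; have := fsize_ge0 R L; lra.
pose delW := Num.min (Num.min delV' e1) (2^-1 / cL).
have delW0 : 0 < delW by rewrite !lt_min delV'0 e10 divr_gt0.
have delWL : fsize R L * delW < 1.
  have : delW * cL <= 2^-1 by rewrite -ler_pdivlMr // /delW ge_min lexx orbT.
  by rewrite /cL; nra.
have delWV : delW <= delV' by rewrite /delW !ge_min lexx.
have delWe : delW <= e1 by rewrite /delW !ge_min lexx orbT.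
(* Invariance under [KV] lets the fine tiles exhaust a coarse tile; invariance under [L], of size at
   least [M], forces coarse tiles to have at least [M] points. *)
have [Q [WW [KW [delW' [delW'0 tlW]]]]] := exists_tiling S_cancel folner (KV `|` L)%fset delW0.
have invWV W : WW W -> invariant KV delV' W.
  by move=> /(tl_inv tlW); apply: invariant_le => //; exact: fsubsetUl.
have bigW W : WW W -> M <= fsize R W.
  move=> WWW; apply: (le_trans ML).
  apply: (invariant_large S_cancel (tl_neq0 tlW WWW) delWL).
  by apply: invariant_le (tl_inv tlW WWW) => //; exact: fsubsetUr.
(* Coordinates on a fine tile [V] contained in a translate [P c]: [(cco V).1] is [c] and
   [(cco V).2 g] is a [t] with [g = t c]. Off the tiles the values are arbitrary. *)
have [cco Hcco] : exists cco : {fset S} -> S * (S -> S), forall V, VV V ->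
    forall g, g \in V -> g = ((cco V).2 g * (cco V).1)%g.
  suff /choice[cco Hcco] : forall V, exists cc : S * (S -> S), VV V ->
    forall g, g \in V -> g = (cc.2 g * cc.1)%g by exists cco.
  move=> V; case: (pselect (VV V)) => [VVV|nV]; last first.
    have [L0 _ L1] := infinite_set_fset 1 S_infinite.
    have /fset0Pn[c _] : L0 != fset0 by rewrite -cardfs_gt0.
    by exists (c, id).
  have [c Hc] := tl_shape tlV VVV.
  have /choice[co Hco] : forall g, exists t, g \in V -> g = (t * c)%g.
    move=> g; case: (boolP (g \in V)) => [/Hc[t _ ->]|_]; first by exists t.
    by exists c.
  by exists (c, co).
pose co V := (cco V).2.
pose dv V x I := deviation V [set g | event I (T (co V g) x)] (pr (event I)).
have dv_le V x I : VV V -> `|dv V x I| <= fsize R V.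
  move=> VVV; rewrite /dv /deviation; have := cnt_ge0 R V [set g | event I (T (co V g) x)].
  have := cnt_le_fsize R V [set g | event I (T (co V g) x)].
  have /andP[] := pr_event01 I; have := fsize_ge0 R V.
  by rewrite ler_norml => ? ? ? ? ?; apply/andP; split; nra.
have [xi Hxi] : exists xi : {fset S} -> {fset S} -> X, forall W,
    \sum_(I <- Is) (\sum_(V <- tiles_in VV W) dv V (xi W V) I) ^+ 2 <=
    D * \sum_(V <- tiles_in VV W) fsize R V ^+ 2.
  suff /choice[xi Hxi] : forall W, exists xi : {fset S} -> X,
    \sum_(I <- Is) (\sum_(V <- tiles_in VV W) dv V (xi V) I) ^+ 2 <=
    D * \sum_(V <- tiles_in VV W) fsize R V ^+ 2 by exists xi.
  move=> W; apply: (greedy_balance mu).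
  - exact: fset_uniq.
  - by move=> V /tiles_inP[_ VVV]; exact: (fsize_tile_ge1 tlV).
  - by move=> V x I /tiles_inP[_ VVV]; exact: dv_le.
  - by move=> V w _; exact: select_point.
pose A := [set g | exists W V, [/\ WW W, VV V, (V `<=` W)%fset, g \in V &
  B (T (co V g) (xi W V))]].
have AE W V g : WW W -> VV V -> (V `<=` W)%fset -> g \in V ->
    A g <-> B (T (co V g) (xi W V)).
  move=> WWW VVV VW gV; split; last by exists W, V.
  move=> [W' [V' [WWW' VVV' VW' gV']]].
  have -> := tl_disj tlV VVV VVV' gV gV'.
  by rewrite (tl_disj tlW WWW WWW' (fsubsetP VW _ gV) (fsubsetP VW' _ gV')).
have patV W V I : WW W -> VV V -> (V `<=` W)%fset -> (I `<=` H)%fset ->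
    `|deviation V (pattern I A) (pr (event I)) - dv V (xi W V) I| <= e1 * fsize R V.
  move=> WWW VVV VW IH.
  apply: (@le_trans _ _ (cnt R V [set g | exists2 h, h \in H & (h * g)%g \notin V])).
    apply: deviation_cnt => g gV nout.
    have hg h : h \in I -> A (h * g)%g <-> B (T h (T (co V g) (xi W V))).
      move=> hI; have hgV : (h * g)%g \in V.
        by case: (boolP (_ \in V)) => // hgV; case: nout; exists h => //; exact: (fsubsetP IH).
      rewrite (AE W V) //.
      (* By right cancellation the coordinates commute with left multiplication: both sides give
         [h g] when multiplied by [c]. This turns the pattern of [A] inside [V] into a pattern of an
         orbit. *)
      have -> : co V (h * g)%g = (h * co V g)%g.
        apply: (@rtranslate_inj _ S_cancel (cco V).1) => /=.
        by rewrite -Hcco // -mulgA -Hcco.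
      by case: T_mps => _ _ <-.
    by split=> Hg h hI; apply/(hg h hI)/Hg.
  apply: (le_trans (cnt_exists (fun h hH => tl_inv tlV VVV hH))).
  by rewrite mulrA ler_wpM2r ?fsize_ge0.
(* Three errors of size [e1]: points outside the fine tiles, points that [H] moves out of their
   tile, and the balanced deviation. *)
have patW W I : WW W -> (I `<=` H)%fset ->
    `|deviation W (pattern I A) (pr (event I))| <= 3 * e1 * fsize R W.
  move=> WWW IH.
  have H1 := deviation_tiles tlV (pattern I A) (pr_event01 I) (invWV _ WWW).
  have H2 : `|\sum_(V <- tiles_in VV W) deviation V (pattern I A) (pr (event I)) -
      \sum_(V <- tiles_in VV W) dv V (xi W V) I| <= e1 * fsize R W.
    rewrite -sumrB; apply: (le_trans (ler_norm_sum _ _ _)).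
    apply: (@le_trans _ _ (e1 * \sum_(V <- tiles_in VV W) fsize R V)).
      rewrite mulr_sumr big_seq [leRHS]big_seq.
      by apply: ler_sum => V /tiles_inP[VW VVV]; exact: patV.
    by apply: ler_wpM2l; [exact: ltW|exact: (sum_fsize_tiles_in tlV)].
  have H3 : `|\sum_(V <- tiles_in VV W) dv V (xi W V) I| <= e1 * fsize R W.
    have e1W : 0 <= e1 * fsize R W by rewrite mulr_ge0 ?fsize_ge0 ?ltW.
    rewrite -(@ler_pXn2r _ 2) ?nnegrE //.
    rewrite real_normK ?num_real //.
    apply: (@le_trans _ _ (\sum_(I <- Is) (\sum_(V <- tiles_in VV W) dv V (xi W V) I) ^+ 2)).
      have IIs : I \in fpowerset H by rewrite fpowersetE.
      by rewrite /Is [leRHS](big_fsetD1 I) //= lerDl sumr_ge0 // => J _; exact: sqr_ge0.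
    apply: (le_trans (Hxi W)).
    apply: (@le_trans _ _ (D * (fsize R P * fsize R W))).
      apply: ler_wpM2l; first exact: ltW.
      apply: (@le_trans _ _ (fsize R P * \sum_(V <- tiles_in VV W) fsize R V)).
        rewrite mulr_sumr big_seq [leRHS]big_seq; apply: ler_sum => V /tiles_inP[_ VVV].
        by rewrite expr2 ler_wpM2r ?fsize_ge0 // (fsize_tile_le tlV).
      by rewrite ler_wpM2l ?fsize_ge0 // (sum_fsize_tiles_in tlV).
    rewrite exprMn mulrA [fsize R W ^+ 2]expr2 mulrA ler_wpM2r ?fsize_ge0 //.
    by rewrite mulrC [leRHS]mulrC -ler_pdivrMr ?exprn_gt0 // [X in X / _]mulrC bigW.
  move: H1 H2 H3; have := fsize_ge0 R W.
  have := ler_wpM2r (fsize_ge0 R W) delVe.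
  rewrite !ler_norml => ? ? /andP[? ?] /andP[? ?] /andP[? ?].
  by apply/andP; split; lra.
exists A, KW, delW'; split => // E invE I IH.
have H1 := deviation_tiles tlW (pattern I A) (pr_event01 I) invE.
have H2 : `|\sum_(W <- tiles_in WW E) deviation W (pattern I A) (pr (event I))|
    <= 3 * e1 * fsize R E.
  apply: (le_trans (ler_norm_sum _ _ _)).
  apply: (@le_trans _ _ (3 * e1 * \sum_(W <- tiles_in WW E) fsize R W)).
    rewrite mulr_sumr big_seq [leRHS]big_seq.
    by apply: ler_sum => W /tiles_inP[WE WWW]; exact: patW.
  by apply: ler_wpM2l; [lra|exact: (sum_fsize_tiles_in tlW)].
move: H1 H2; have := ler_wpM2r (fsize_ge0 R E) delWe.
have : eps * fsize R E = 4 * (e1 * fsize R E) by rewrite /e1; lra.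
rewrite !ler_norml => ? ? /andP[? ?] /andP[? ?].
by apply/andP; split; lra.
Qed.

End UniformApproximation.

(** * Gluing *)

Section Gluing.
Context (R : realType) (S : semigroupType).
Hypothesis S_cancel : cancellative S.

(** Add to [Z] the tile [t x] of each of its points, empty when no tile contains [x]. By
    disjointness a tile that meets an added tile is that tile. *)
Lemma tiling_saturate (P K : {fset S}) (del : R) VV K' (del' : R) (Z : {fset S}) :
  tiling P K del VV K' del' -> exists2 Z' : {fset S}, (Z `<=` Z')%fset &
    forall V x, VV V -> x \in V -> x \in Z' -> (V `<=` Z')%fset.
Proof.
move=> tl.
have /choice[t Ht] : forall x, exists V : {fset S},
    (V = fset0 \/ VV V) /\ forall W, VV W -> x \in W -> W = V.
  move=> x; case: (pselect (exists2 V, VV V & x \in V)) => [[V VVV xV]|nV].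
    by exists V; split; [right|move=> W VVW xW; exact: (tl_disj tl VVW VVV xW xV)].
  by exists fset0; split; [left|move=> W VVW xW; case: nV; exists W].
exists (Z `|` \bigcup_(x <- Z) t x)%fset; first exact: fsubsetUl.
move=> V x VVV xV xO'.
have [y yO ->] : exists2 y, y \in Z & V = t y.
  move: xO'; rewrite inE => /orP[xO|]; first by exists x => //; exact: (Ht x).2.
  move=> /bigfcupP[y]; rewrite andbT => yO xty; exists y => //.
  case: (Ht y) => -[ty0|VVty] _; first by rewrite ty0 inE in xty.
  exact: (tl_disj tl VVV VVty xV xty).
apply/fsubsetP => z zty; rewrite inE; apply/orP; right.
by apply/bigfcupP; exists y => //; rewrite yO.
Qed.

Lemma folner_large (F : nat -> {fset S}) (M : R) :
  infinite_set [set: S] -> folner_sequence R F ->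
  exists n, forall N, (n <= N)%N -> M <= fsize R (F N).
Proof.
move=> Sinf FF; have [L _ LM] := infinite_set_fset (Num.bound `|M|) Sinf.
have ML : M <= fsize R L.
  rewrite (le_trans (ler_norm M)) // (le_trans (ltW (archi_boundP (normr_ge0 M)))) //.
  by rewrite ler_nat.
have c0 : 0 < 1 + fsize R L by have := fsize_ge0 R L; lra.
have d0 : 0 < (1 + fsize R L)^-1 by rewrite invr_gt0.
have [n Hn] := folner_invariant S_cancel L FF d0.
exists n => N /Hn invF; apply: (le_trans ML).
apply: (invariant_large S_cancel _ _ invF); first exact: (FF.1 N).
by rewrite ltr_pdivrMr // mul1r; lra.
Qed.

Lemma deviation_pattern_eq (V I : {fset S}) (A A' : set S) (del m : R) :
  invariant I del V -> (forall x, x \in V -> A x <-> A' x) ->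
  `|deviation V (pattern I A) m - deviation V (pattern I A') m|
    <= fsize R I * del * fsize R V.
Proof.
move=> invV AA'; rewrite -mulrA; apply: le_trans (cnt_exists invV).
apply: deviation_cnt => g gV nout.
have hgV h : h \in I -> (h * g)%g \in V.
  by move=> hI; case: (boolP (_ \in V)) => // hgV; case: nout; exists h.
by split=> Hg h hI; apply/(AA' _ (hgV h hI))/Hg.
Qed.

Lemma cnt_translate_in (E K I : {fset S}) :
  cnt R E [set g | exists2 h, h \in I & (h * g)%g \in K] <= fsize R I * fsize R K.
Proof.
apply: cnt_exists => h _; rewrite -[leRHS]cntT.
by apply: (cnt_le_inj _ (@ltranslate_inj _ S_cancel h)).
Qed.

Lemma increasing_bracket (n_ : nat -> nat) j0 N :
  (forall j, n_ j < n_ j.+1)%N -> (n_ j0 <= N)%N ->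
  exists j, [/\ j0 <= j, n_ j <= N & N < n_ j.+1]%N.
Proof.
move=> inc; elim: N => [|N IH].
  rewrite leqn0 => /eqP n0; exists j0; split => //; first by rewrite n0.
  by rewrite -n0 inc.
rewrite leq_eqVlt => /predU1P[n0|/IH[j [jj nj Nj]]].
  by exists j0; split => //; rewrite -n0 ?inc.
have [lt|ge] := ltnP N.+1 (n_ j.+1); first by exists j; split => //; exact: ltnW.
by exists j.+1; split; [exact: leqW|exact: ge|exact: leq_ltn_trans Nj (inc _)].
Qed.

Lemma countable_exhaustion : countable [set: S] -> infinite_set [set: S] ->
  exists H : nat -> {fset S}, forall L : {fset S},
    exists j0, forall j, (j0 <= j)%N -> (L `<=` H j)%fset.
Proof.
move=> /countable_injP[f f_inj] Sinf.
have [L0 _ L1] := infinite_set_fset 1 Sinf.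
have /fset0Pn[s0 _] : L0 != fset0 by rewrite -cardfs_gt0.
have /choice[e He] : forall n, exists s, forall t, f t = n -> t = s.
  move=> n; case: (pselect (exists s, f s = n)) => [[s fs]|ns]; last first.
    by exists s0 => t ft; case: ns; exists t.
  by exists s => t ft; apply: f_inj; rewrite ?in_setT // ft fs.
exists (fun j => [fset e i | i in iota 0 j]%fset) => L.
suff [j0 Hj0] : exists j0, forall s, s \in (L : seq S) -> (f s < j0)%N.
  exists j0 => j j0j; apply/fsubsetP => s sL; apply/imfsetP; exists (f s) => /=.
    by rewrite mem_iota /= add0n (leq_trans (Hj0 s sL)).
  exact: He.
elim: (L : seq S) => [|s l [j0 Hj0]]; first by exists 0%N.
exists (maxn (f s).+1 j0) => t; rewrite inE => /predU1P[->|/Hj0 tj].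
  exact: leq_maxl.
exact: leq_trans tj (leq_maxr _ _).
Qed.

End Gluing.

(** * Passing from one approximation to the next along the Folner sequence *)

Section Main.
Context (R : realType) (S : semigroupType).
Hypothesis S_cancel : cancellative S.
Hypothesis S_countable : countable [set: S].
Hypothesis S_infinite : infinite_set [set: S].
Context (F : nat -> {fset S}).
Hypothesis F_folner : folner_sequence R F.
Context (m : {fset S} -> R).
Hypothesis m01 : forall I, 0 <= m I <= 1.
Hypothesis approx : forall (H : {fset S}) (eps : R), 0 < eps ->
  exists A K (del : R), 0 < del /\ forall E, invariant K del E ->
    forall I, (I `<=` H)%fset -> `|deviation E (pattern I A) (m I)| <= eps * fsize R E.

Lemma glue_approximations : exists A : set S, forall (I : {fset S}) (eps : R), 0 < eps ->
  exists n, forall N, (n <= N)%N ->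
    `|deviation (F N) (pattern I A) (m I)| <= eps * fsize R (F N).
Proof.
have folner (K : {fset S}) (del : R) : 0 < del ->
    exists2 T : {fset S}, T != fset0 & invariant K del T.
  move=> del0; have [n Hn] := folner_invariant S_cancel K F_folner del0.
  by exists (F n); [exact: (F_folner.1 n)|exact: Hn].
have [H HH] := countable_exhaustion S_countable S_infinite.
pose e j : R := j.+1%:R^-1.
have e0 j : 0 < e j by rewrite invr_gt0.
have e_le i j : (i <= j)%N -> e j <= e i.
  by move=> ij; rewrite lef_pV2 ?posrE ?ltr0n // ler_nat ltnS.
have [A_ [K_ [del_ [del_0 HA]]]] : exists (A_ : nat -> set S)
    (K_ : nat -> {fset S}) (del_ : nat -> R),
    (forall j, 0 < del_ j) /\ forall j E, invariant (K_ j) (del_ j) E ->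
    forall I, (I `<=` H j)%fset ->
      `|deviation E (pattern I (A_ j)) (m I)| <= e j * fsize R E.
  suff /choice[f Hf] : forall j, exists AKd : set S * {fset S} * R, 0 < AKd.2 /\
      forall E, invariant AKd.1.2 AKd.2 E -> forall I, (I `<=` H j)%fset ->
      `|deviation E (pattern I AKd.1.1) (m I)| <= e j * fsize R E.
    exists (fun j => (f j).1.1), (fun j => (f j).1.2), (fun j => (f j).2).
    by split=> j; have [] := Hf j.
  by move=> j; have [A [K [del HAKd]]] := approx (H j) (e0 j); exists (A, K, del).
(* Tiles of level [j] must suit both [A_ j] and [A_ j.+1], since each relevant tile will carry one
   of the two. *)
pose Kt j := (K_ j `|` K_ j.+1 `|` H j)%fset.
pose dt j := Num.min (Num.min (del_ j) (del_ j.+1)) (e j).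
have dt0 j : 0 < dt j by rewrite !lt_min !del_0 e0.
have [P_ [VV [K' [del' [del'0 tl]]]]] : exists (P_ : nat -> {fset S})
    (VV : nat -> set {fset S}) (K' : nat -> {fset S}) (del' : nat -> R),
    (forall j, 0 < del' j) /\ forall j, tiling (P_ j) (Kt j) (dt j) (VV j) (K' j) (del' j).
  suff /choice[f Hf] : forall j, exists q : {fset S} * set {fset S} * {fset S} * R,
      0 < q.2 /\ tiling q.1.1.1 (Kt j) (dt j) q.1.1.2 q.1.2 q.2.
    exists (fun j => (f j).1.1.1), (fun j => (f j).1.1.2), (fun j => (f j).1.2),
      (fun j => (f j).2).
    by split=> j; have [] := Hf j.
  move=> j; have [P [VV [K' [del' Hq]]]] := exists_tiling S_cancel folner (Kt j) (dt0 j).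
  by exists (P, VV, K', del').
have tile_inv j V : VV j V -> [/\ invariant (K_ j) (del_ j) V,
    invariant (K_ j.+1) (del_ j.+1) V & invariant (H j) (e j) V].
  move=> VVV; have inv := tl_inv (tl j) VVV.
  split; apply: invariant_le inv; rewrite /Kt /dt ?ge_min ?lexx ?orbT //.
  - by rewrite -fsetUA fsubsetUl.
  - by rewrite fsetUAC fsubsetUr.
  - exact: fsubsetUr.
(* From index [g j Psi] on, [F N] is filled by tiles of level [j] up to a fraction [dt j], and [Psi]
   has at most [e j |F N|] points. *)
have [g Hg] : exists g : nat -> {fset S} -> nat, forall j (Psi : {fset S}) N,
    (g j Psi <= N)%N -> invariant (K' j) (del' j) (F N) /\
    j.+1%:R * fsize R Psi <= fsize R (F N).
  suff /choice[g Hg] : forall jP : nat * {fset S}, exists n, forall N, (n <= N)%N ->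
      invariant (K' jP.1) (del' jP.1) (F N) /\
      jP.1.+1%:R * fsize R jP.2 <= fsize R (F N).
    by exists (fun j Psi => g (j, Psi)) => j Psi; exact: (Hg (j, Psi)).
  move=> [j Psi] /=.
  have [n1 H1] := folner_invariant S_cancel (K' j) F_folner (del'0 j).
  have [n2 H2] := folner_large S_cancel (j.+1%:R * fsize R Psi) S_infinite F_folner.
  exists (maxn n1 n2) => N; rewrite geq_max => /andP[/H1 ? /H2 ?]; by [].
have [sat Hsat] : exists sat : nat -> nat -> {fset S}, forall j n,
    (forall N, (N < n)%N -> (F N `<=` sat j n)%fset) /\
    forall V x, VV j V -> x \in V -> x \in sat j n -> (V `<=` sat j n)%fset.
  suff /choice[f Hf] : forall jn : nat * nat, exists Z : {fset S},
      (forall N, (N < jn.2)%N -> (F N `<=` Z)%fset) /\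
      forall V x, VV jn.1 V -> x \in V -> x \in Z -> (V `<=` Z)%fset.
    by exists (fun j n => f (j, n)) => j n; exact: (Hf (j, n)).
  move=> [j n] /=.
  have [Z Z1 Z2] := tiling_saturate (\bigcup_(N <- iota 0 n) F N)%fset (tl j).
  exists Z; split => // N Nn; apply: fsubset_trans Z1.
  apply/fsubsetP => x xF; apply/bigfcupP; exists N => //.
  by rewrite mem_iota /= add0n Nn.
(* The stages: [n_ j.+1] is at least [g j (Psi j)], [Om j] is saturated at level [j] and contains
   all [F N] with [N < n_ j.+1], and [Psi j] is the union of the earlier [Om i]. *)
pose next j (st : nat * {fset S}) :=
  let n := maxn st.1.+1 (g j st.2) in (n, (st.2 `|` sat j n)%fset).
pose st := fix st (j : nat) : nat * {fset S} :=
  if j is i.+1 then next i (st i) else (0%N, fset0).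
pose n_ j := (st j).1.
pose Psi j := (st j).2.
pose Om j := sat j (n_ j.+1).
have PsiS j : Psi j.+1 = (Psi j `|` Om j)%fset by [].
have n_inc j : (n_ j < n_ j.+1)%N by rewrite /n_ /= leq_maxl.
have n_g j : (g j (Psi j) <= n_ j.+1)%N by rewrite /n_ /= leq_maxr.
have OmPsi i j x : (i < j)%N -> x \in Om i -> x \in Psi j.
  elim: j => // j IH; rewrite ltnS leq_eqVlt PsiS inE => /predU1P[->|ij] xi.
    by rewrite xi orbT.
  by rewrite IH.
(* The layers [Om j \ Psi j] are disjoint, and [A] copies [A_ j] on the layer of index [j]. *)
pose A := [set x | exists j, [/\ A_ j x, x \in Om j & x \notin Psi j]].
have AE j x : x \in Om j -> x \notin Psi j -> A x <-> A_ j x.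
  move=> xO xP; split; last by exists j.
  move=> [i [Aix xOi xPi]]; case: (ltngtP i j) => [ij|ji|<-//].
    by rewrite (OmPsi i j) in xP.
  by rewrite (OmPsi j i) in xPi.
exists A => I eps eps0.
have est j N : (I `<=` H j)%fset -> (I `<=` H j.+1)%fset ->
    (n_ j.+1 <= N)%N -> (N < n_ j.+2)%N ->
    `|deviation (F N) (pattern I A) (m I)| <= (2 * fsize R I + 2) * e j * fsize R (F N).
  move=> IHj IHj1 nN Nn.
  have [invF largeF] := Hg j _ N (leq_trans (n_g j) nN).
  have FOm : (F N `<=` Om j.+1)%fset by have [+ _] := Hsat j.+1 (n_ j.+2); exact.
  (* [A'] differs from [A] only on [Psi j], and on every tile of level [j] inside [F N]
     it is one of [A_ j], [A_ j.+1]. *)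
  pose A' := [set x | [\/ x \in Om j /\ A_ j x, [/\ x \notin Om j, x \in Psi j & A_ j.+1 x] |
    [/\ x \notin Om j, x \notin Psi j & A x]]].
  have H1 : `|deviation (F N) (pattern I A) (m I) - deviation (F N) (pattern I A') (m I)|
      <= fsize R I * e j * fsize R (F N).
    (* Only points that some element of [I] moves into [Psi j] matter; the choice of [n_ j.+1] makes
       them negligible in [F N]. *)
    apply: (@le_trans _ _ (fsize R I * fsize R (Psi j))).
      apply: le_trans (cnt_translate_in R S_cancel (F N) (Psi j) I).
      apply: deviation_cnt => x _ nP.
      have AA' h : h \in I -> A (h * x)%g <-> A' (h * x)%g.
        move=> hI; have hP : (h * x)%g \notin Psi j by apply/negP => hP; apply: nP; exists h.
        case: (boolP ((h * x)%g \in Om j)) => hO.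
          rewrite (AE j) // /A' /=; split; first by constructor 1.
          by case=> -[] //; rewrite ?hO.
        split; first by constructor 3.
        by case=> -[] //; rewrite ?(negbTE hO) ?(negbTE hP).
      by split=> Hx h hI; apply/(AA' h hI)/Hx.
    rewrite -mulrA; apply: ler_wpM2l; first exact: fsize_ge0.
    by rewrite /e -ler_pdivrMl ?invr_gt0 ?ltr0n // invrK.
  have H2 := deviation_tiles (tl j) (pattern I A') (m01 I) invF.
  have H3 : `|\sum_(V <- tiles_in (VV j) (F N)) deviation V (pattern I A') (m I)|
      <= (fsize R I + 1) * e j * fsize R (F N).
    apply: (le_trans (ler_norm_sum _ _ _)).
    apply: (@le_trans _ _ ((fsize R I + 1) * e j *
        \sum_(V <- tiles_in (VV j) (F N)) fsize R V)); last first.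
      apply: ler_wpM2l; last exact: (sum_fsize_tiles_in (tl j)).
      by rewrite mulr_ge0 ?addr_ge0 ?fsize_ge0 // ltW.
    rewrite mulr_sumr big_seq [leRHS]big_seq; apply: ler_sum => V /tiles_inP[VF VVV].
    have [inv1 inv2 inv3] := tile_inv _ _ VVV.
    have invI : invariant I (e j) V by exact: invariant_le inv3.
    have [k [kk dk AVk]] : exists k, [/\ e k <= e j,
        `|deviation V (pattern I (A_ k)) (m I)| <= e k * fsize R V &
        forall x, x \in V -> A' x <-> A_ k x].
      (* A tile inside [Om j] carries [A_ j]. By saturation any other tile is disjoint from [Om j];
         there [A'] is [A_ j.+1] on [Psi j] by definition, and the remaining points lie in the layer
         of index [j.+1]. *)
      case: (pselect (V `<=` Om j)%fset) => [/fsubsetP VO|VO].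
        exists j; split => //; first exact: HA.
        move=> x /VO xO; split; last by constructor 1.
        by case=> -[] //; rewrite ?xO.
      exists j.+1; split; [exact: e_le|exact: HA|] => x xV.
      have xO : x \notin Om j.
        by apply/negP => xO; apply: VO; have [_ ] := Hsat j (n_ j.+1); apply; eassumption.
      have xF := fsubsetP FOm _ (fsubsetP VF _ xV).
      case: (boolP (x \in Psi j)) => xP; split.
      - by case=> -[] //; rewrite ?(negbTE xO) ?xP.
      - by constructor 2.
      - case=> -[]; rewrite ?(negbTE xO) ?(negbTE xP) // => _ _ /(AE j.+1); apply => //.
        by rewrite PsiS inE negb_or xP.
      - move=> Ax; constructor 3; split => //; apply/(AE j.+1) => //.
        by rewrite PsiS inE negb_or xP.
    have := deviation_pattern_eq (m I) invI AVk.
    have := ler_wpM2r (fsize_ge0 R V) kk.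
    move: dk; rewrite !ler_norml => /andP[? ?] ? /andP[? ?].
    by apply/andP; split; lra.
  have : dt j * fsize R (F N) <= e j * fsize R (F N).
    by rewrite ler_wpM2r ?fsize_ge0 // /dt ge_min lexx orbT.
  move: H1 H2 H3; rewrite !ler_norml => /andP[? ?] /andP[? ?] /andP[? ?] ?.
  by apply/andP; split; lra.
have [j1 Hj1] := HH I.
pose c := 2 * fsize R I + 2; have c0 : 0 < c by rewrite /c; have := fsize_ge0 R I; lra.
(* From [j0] on, [H j] contains [I] and [c * e j <= eps]. *)
pose j0 := maxn j1 (Num.bound (c / eps)).
exists (n_ j0.+1) => N /(@increasing_bracket (fun j => n_ j.+1) j0 N (fun j => n_inc j.+1)).
move=> [j [j0j nN Nn]].
have j1j : (j1 <= j)%N by exact: leq_trans (leq_maxl _ _) j0j.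
apply: (le_trans (est j N (Hj1 _ j1j) (Hj1 _ (leqW j1j)) nN Nn)).
apply: ler_wpM2r; first exact: fsize_ge0.
rewrite -/c /e ler_pdivrMr ?ltr0n // -ler_pdivrMl // mulrC.
apply: (le_trans (ltW (archi_boundP _))); first by rewrite divr_ge0 // ltW.
by rewrite ler_nat; apply: leqW; exact: leq_trans (leq_maxr _ _) j0j.
Qed.

End Main.

Theorem theorem3p20 (R : realType) (S : semigroupType)
    (S_countable : countable [set: S])
    (S_infinite : infinite_set [set: S])
    (S_amenable : left_amenable R S)
    (S_cancellative : cancellative S)
    (F : nat -> {fset S})
    (F_folner : folner_sequence R F)
    (d : measure_display) (X : measurableType d) (mu : probability X R)
    (T : S -> X -> X)
    (T_mps : measure_preserving_action mu T)
    (B : set X) (B_measurable : measurable B) :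
  exists A : set S,
    forall (k : nat) (h : 'I_k -> S),
      has_density F (\bigcap_i ltranslate_preimage (h i) A)
        (fine (mu (\bigcap_i (T (h i) @^-1` B)))).
Proof.
have folner (K : {fset S}) (del : R) : 0 < del ->
    exists2 U : {fset S}, U != fset0 & invariant K del U.
  move=> del0; have [n Hn] := folner_invariant S_cancellative K F_folner del0.
  by exists (F n); [exact: (F_folner.1 n)|exact: Hn].
have [A HA] := glue_approximations S_cancellative S_countable S_infinite F_folner
  (pr_event01 T_mps B_measurable)
  (uniform_approximation S_cancellative S_infinite folner T_mps B_measurable).
(* Only the set of values of [h] matters; for [k = 0] both intersections are the whole space. *)
exists A => k h; pose I := [fset h i | i in 'I_k]%fset.
have inI i : h i \in I by apply/imfsetP; exists i.
have -> : \bigcap_i ltranslate_preimage (h i) A = pattern I A.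
  apply/seteqP; split=> [g Hg _ /imfsetP[i _ ->]|g Hg i _]; first exact: Hg.
  exact: Hg.
have -> : \bigcap_i (T (h i) @^-1` B) = event T B I.
  apply/seteqP; split=> [x Hx _ /imfsetP[i _ ->]|x Hx i _]; first exact: Hx.
  exact: Hx.
apply/cvgrPdist_le => eps eps0; have [n Hn] := HA I eps eps0.
exists n => // N /= /Hn devF.
have F0 : 0 < fsize R (F N) by apply: fsize_gt0; exact: (F_folner.1 N).
rewrite distrC -[leLHS](@mulfK _ (fsize R (F N))) ?gt_eqF // ler_pdivrMr //.
apply: le_trans devF; rewrite -[X in _ * X](gtr0_norm F0) -normrM /deviation.
by rewrite mulrBl -[X in X - _]/(cnt R (F N) (pattern I A) / fsize R (F N) * _) divfK ?gt_eqF.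
Qed.
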